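(* For $f(X):=\|X\|_{Fro}^2$ on the symmetric real $n\times n$ matrices, and any positive integer $k<n$, it holds that $$g(X)\ge\frac1k\qquad\text{for all }X\in\mathcal{S}\text{ with }\mathrm{Rk}(X)\le k.$$
   Context: $\mathcal{S}:=\{X\in\mathbb{S}^{n\times n} : X\succeq0,\ \mathrm{Tr}(X)=1\}$ is the spectahedron, where $\mathbb{S}^{n\times n}$ is the space of symmetric real $n\times n$ matrices with Frobenius inner product $A\bullet B:=\mathrm{Tr}(A^TB)$ and Frobenius norm $\|\cdot\|_{Fro}$; $\mathrm{Rk}$ is the rank. The duality gap of a differentiable convex $f$ over $\mathcal{S}$ at $X\in\mathcal{S}$ is $$g(X):=\max_{Y\in\mathcal{S}}(X-Y)\bullet\nabla f(X)=X\bullet\nabla f(X)-\lambda_{\min}(\nabla f(X)).$$ *)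

(* Defs.v *)
From mathcomp Require Import all_boot all_order all_algebra.
From mathcomp Require Import all_classical all_reals all_analysis.

Set Implicit Arguments.
Unset Strict Implicit.
Unset Printing Implicit Defensive.

Import Order.TTheory GRing.Theory Num.Theory.
Import numFieldNormedType.Exports.
Local Open Scope classical_set_scope.
Local Open Scope ring_scope.

Section Spectahedron.
Variables (R : realType) (n : nat).
Implicit Types (A B X Y G H : 'M[R]_n) (f : 'M[R]_n -> R).

Definition symmetric_matrices : set 'M[R]_n :=
  [set X | X \is symmetricmx].

Definition psd X : Prop :=
  X \is symmetricmx /\ forall v : 'cV[R]_n, 0 <= \tr (v^T *m X *m v).

Definition spectahedron : set 'M[R]_n := [set X | psd X /\ \tr X = 1].

Definition frob_dot A B : R := \tr (A^T *m B).

Definition frob_norm A : R := Num.sqrt (frob_dot A A).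

(* G is the gradient at X of the restriction of f to the Euclidean space of
   symmetric matrices: G is symmetric and represents, for the Frobenius inner
   product, the Frechet derivative of that restriction. Increments H are
   symmetric, so the values of f at non-symmetric matrices play no role. *)
Definition is_gradient f X G : Prop :=
  symmetric_matrices G /\
  (f (X + H) - f X - frob_dot G H) / frob_norm H
    @[H --> within symmetric_matrices (0 : 'M[R]_n)^'] --> (0 : R).

(* The default value 0 is used when f has no gradient at X. *)
Definition gradient f X : 'M[R]_n := xget 0 (is_gradient f X).

(* The largest element of E, or 0 if E has none. *)
Definition maximum (E : set R) : R := xget 0 (E `&` ubound E).

Definition duality_gap f X : R :=
  maximum [set frob_dot (X - Y) (gradient f X) | Y in spectahedron].

End Spectahedron.

(* Main.v *)
Require Import Defs.
From mathcomp Require Import all_boot all_order all_algebra.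
From mathcomp Require Import all_classical all_reals all_analysis.
From mathcomp Require Import ring lra.
Import Order.TTheory GRing.Theory Num.Theory.
Import numFieldNormedType.Exports.
Local Open Scope classical_set_scope.
Local Open Scope ring_scope.

(** Write <A, B> for the Frobenius product. The gradient of the squared norm at X
    is 2 X, so the gap at X is the maximum over Y in the spectahedron of
    2 <X, X> - 2 <Y, X>. Two psd matrices have a nonnegative product
    ([psd_trace_mul_ge0]), and since X has rank at most k < n, the normalised
    projector onto its kernel is a Y with <Y, X> = 0 ([spectahedron_orthogonal]).
    Hence the maximum is attained and equals 2 <X, X>.

    It remains to bound <X, X> from below. If P is the orthogonal projector onto
    the row space of X, then 1 = \tr X = <P, X> and <P, P> = \rank X, so
    Cauchy-Schwarz gives <X, X> >= 1 / \rank X >= 1 / k ([sqr_trace_le_rank]).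

    The gradient is specified by a limit along symmetric increments, and choosing
    it is legitimate because such a gradient is unique ([is_gradient_unique]). *)

Set Implicit Arguments.
Unset Strict Implicit.

(** * Frobenius geometry *)

Lemma symmetricmxE (R : realType) (n : nat) (A : 'M[R]_n) :
  (A \is symmetricmx) = (A^T == A).
Proof. by rewrite qualifE /= expr0 scale1r map_mx_id // eq_sym. Qed.

Lemma trace_gram_ge0 (R : realType) (m n : nat) (A : 'M[R]_(m, n)) :
  0 <= \tr (A^T *m A).
Proof.
apply: sumr_ge0 => j _; rewrite mxE; apply: sumr_ge0 => i _.
by rewrite mxE -expr2 sqr_ge0.
Qed.

Lemma frob_dotE (R : realType) (n : nat) (A B : 'M[R]_n) :
  frob_dot A B = \sum_i \sum_j A i j * B i j.
Proof.
rewrite /frob_dot /mxtrace exchange_big /=.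
by apply: eq_bigr => j _; rewrite mxE; apply: eq_bigr => i _; rewrite mxE.
Qed.

Lemma frob_dotC (R : realType) (n : nat) (A B : 'M[R]_n) :
  frob_dot A B = frob_dot B A.
Proof. by rewrite /frob_dot -mxtrace_tr trmx_mul trmxK. Qed.

Lemma frob_dotDl (R : realType) (n : nat) (A B C : 'M[R]_n) :
  frob_dot (A + B) C = frob_dot A C + frob_dot B C.
Proof. by rewrite /frob_dot linearD mulmxDl linearD. Qed.

Lemma frob_dotZl (R : realType) (n : nat) (a : R) (A B : 'M[R]_n) :
  frob_dot (a *: A) B = a * frob_dot A B.
Proof. by rewrite /frob_dot linearZ -scalemxAl linearZ. Qed.

Lemma frob_dotBl (R : realType) (n : nat) (A B C : 'M[R]_n) :
  frob_dot (A - B) C = frob_dot A C - frob_dot B C.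
Proof. by rewrite -scaleN1r frob_dotDl frob_dotZl mulN1r. Qed.

Lemma frob_dot_ge0 (R : realType) (n : nat) (A : 'M[R]_n) : 0 <= frob_dot A A.
Proof. exact: trace_gram_ge0. Qed.

Lemma frob_dot_eq0 (R : realType) (n : nat) (A : 'M[R]_n) :
  frob_dot A A = 0 -> A = 0.
Proof.
rewrite frob_dotE => /eqP; rewrite psumr_eq0; last first.
  by move=> i _; apply: sumr_ge0 => j _; rewrite -expr2 sqr_ge0.
move=> /allP A0; apply/matrixP => i j; rewrite mxE.
have := A0 i (mem_index_enum i); rewrite psumr_eq0; last first.
  by move=> ? _; rewrite -expr2 sqr_ge0.
move=> /allP /(_ j (mem_index_enum j)) /=.
by rewrite mulf_eq0 orbb => /eqP.
Qed.

Lemma sqr_frob_norm (R : realType) (n : nat) (A : 'M[R]_n) :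
  frob_norm A ^+ 2 = frob_dot A A.
Proof. by rewrite sqr_sqrtr // frob_dot_ge0. Qed.

Lemma frob_normZ (R : realType) (n : nat) (a : R) (A : 'M[R]_n) :
  0 <= a -> frob_norm (a *: A) = a * frob_norm A.
Proof.
move=> a0; rewrite /frob_norm frob_dotZl frob_dotC frob_dotZl mulrA -expr2.
by rewrite sqrtrM ?sqr_ge0 // sqrtr_sqr ger0_norm.
Qed.

Lemma frob_norm_gt0 (R : realType) (n : nat) (A : 'M[R]_n) :
  A != 0 -> 0 < frob_norm A.
Proof.
move=> A0; rewrite sqrtr_gt0 lt_def frob_dot_ge0 andbT.
by apply: contraNneq A0 => /frob_dot_eq0 ->.
Qed.

Lemma ler_entry_frob_norm (R : realType) (n : nat) (A : 'M[R]_n) (i j : 'I_n) :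
  `|A i j| <= frob_norm A.
Proof.
rewrite -(sqrtr_sqr (A i j)) ler_wsqrtr // frob_dotE (bigD1 i) //= (bigD1 j) //=.
rewrite expr2 -addrA lerDl addr_ge0 //.
  by apply: sumr_ge0 => ? _; rewrite -expr2 sqr_ge0.
by do 2!apply: sumr_ge0 => ? _; rewrite -expr2 sqr_ge0.
Qed.

(** * Orthogonal projectors and the rank *)

Lemma sqnorm_rV_eq0 (R : realType) (m : nat) (u : 'rV[R]_m) :
  u *m u^T = 0 -> u = 0.
Proof.
move=> /matrixP /(_ 0 0); rewrite !mxE => /eqP; rewrite psumr_eq0; last first.
  by move=> j _; rewrite mxE -expr2 sqr_ge0.
move=> /allP u0; apply/rowP => j; have := u0 j (mem_index_enum j).
by rewrite !mxE mulf_eq0 orbb => /eqP.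
Qed.

(** If u *m B *m B^T = 0, then u *m B has norm zero, and the rows of B are
    independent. *)
Lemma gram_unitmx (R : realType) (m n : nat) (B : 'M[R]_(m, n)) :
  row_free B -> B *m B^T \in unitmx.
Proof.
move=> freeB; rewrite -row_free_unit -kermx_eq0; apply/eqP/row_matrixP => i.
rewrite row0; set u := row i _.
have uBB : u *m (B *m B^T) = 0 by rewrite -row_mul mulmx_ker row0.
have /sqnorm_rV_eq0 uB0 : (u *m B) *m (u *m B)^T = 0.
  by rewrite trmx_mul !mulmxA -(mulmxA u) uBB mul0mx.
by apply: (row_free_inj freeB); rewrite uB0 mul0mx.
Qed.

(** The orthogonal projector onto the row space of A is B^T (B B^T)^-1 B for any
    basis B of that space. *)
Lemma row_space_projector (R : realType) (m n : nat) (A : 'M[R]_(m, n)) :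
  exists P : 'M[R]_n,
    [/\ P^T = P, P *m P = P, A *m P = A & \tr P = (\rank A)%:R].
Proof.
have: row_free (row_base A) by exact: row_base_free.
have: (A <= row_base A)%MS by rewrite eq_row_base.
move: (\rank A) (row_base A) => r B /submxP[C ->] /gram_unitmx GU.
exists (B^T *m invmx (B *m B^T) *m B); split.
- by rewrite !trmx_mul trmxK trmx_inv trmx_mul trmxK mulmxA.
- by rewrite !mulmxA -(mulmxA (B^T *m _) B) mulmxKV.
- by rewrite !mulmxA -(mulmxA C B) mulmxK.
- by rewrite -mulmxA mxtrace_mulC -mulmxA mulVmx // mxtrace1.
Qed.

(** Cauchy-Schwarz against the orthogonal projector P onto the row space of X:
    \tr X is the Frobenius product of X and P, and the squared norm of P is the
    rank of X. *)
Lemma sqr_trace_le_rank (R : realType) (n : nat) (X : 'M[R]_n) :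
  (\tr X) ^+ 2 <= (\rank X)%:R * frob_dot X X.
Proof.
have [r0|rX] := posnP (\rank X).
  move: (r0) => /eqP; rewrite mxrank_eq0 => /eqP X0.
  by rewrite r0 mul0r X0 mxtrace0 expr0n.
have [P [symP idP XP trP]] := row_space_projector X.
have dotPX : frob_dot P X = \tr X by rewrite /frob_dot symP mxtrace_mulC XP.
have dotPP : frob_dot P P = (\rank X)%:R by rewrite /frob_dot symP idP trP.
set r : R := (\rank X)%:R in dotPP *; set t := \tr X in dotPX *.
have r0 : 0 < r by rewrite ltr0n.
(* t / r is the coefficient of the orthogonal projection of X onto the line of P;
   scaling by r avoids the division. *)
have := frob_dot_ge0 (r *: X - t *: P).
rewrite frob_dotBl !frob_dotZl ![frob_dot _ (_ - _)]frob_dotC !frob_dotBl.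
rewrite !frob_dotZl (frob_dotC X P) dotPX dotPP => ge0.
rewrite -subr_ge0 -(pmulr_rge0 _ r0); apply: le_trans ge0 _.
by rewrite le_eqVlt; apply/orP; left; apply/eqP; ring.
Qed.

(** * Positive semidefinite matrices *)

Lemma psd_congr (R : realType) (n : nat) (A P : 'M[R]_n) :
  psd A -> psd (P *m A *m P^T).
Proof.
move=> [symA posA]; split.
  move: symA; rewrite !symmetricmxE => /eqP symA.
  by rewrite !trmx_mul trmxK symA mulmxA.
by move=> v; have := posA (P^T *m v); rewrite trmx_mul trmxK !mulmxA.
Qed.

Lemma quad_delta (R : realType) (n : nat) (A : 'M[R]_n) (i j : 'I_n) :
  \tr ((delta_mx i 0 : 'cV[R]_n)^T *m A *m (delta_mx j 0 : 'cV[R]_n)) = A i j.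
Proof. by rewrite trmx_delta -rowE -colE trace_mx11 !mxE. Qed.

Lemma psd_diag_ge0 (R : realType) (n : nat) (A : 'M[R]_n) (i : 'I_n) :
  psd A -> 0 <= A i i.
Proof. by move=> [_ /(_ (delta_mx i 0))]; rewrite quad_delta. Qed.

Lemma psd_diag0 (R : realType) (n : nat) (A : 'M[R]_n) :
  psd A -> (forall i, A i i = 0) -> A = 0.
Proof.
move=> [symA posA] A0; apply/matrixP => i j; rewrite mxE.
have AE : A j i = A i j.
  by move: symA; rewrite symmetricmxE => /eqP /matrixP/(_ i j); rewrite mxE.
have q c : \tr ((delta_mx i 0 + c *: delta_mx j 0 : 'cV[R]_n)^T *m A *m
    (delta_mx i 0 + c *: delta_mx j 0)) = (c *+ 2) * A i j.
  rewrite !linearD /= !linearZ /= !mulmxDl !linearD /= -!scalemxAl !linearZ /=.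
  by rewrite !quad_delta !A0 AE; ring.
(* On e_i + e_j and e_i - e_j the form takes opposite values. *)
have := posA (delta_mx i 0 + 1 *: delta_mx j 0).
have := posA (delta_mx i 0 + (-1) *: delta_mx j 0).
by rewrite !q => ? ?; lra.
Qed.

(** A is a sum of rank-one matrices w *m w^T, each of which contributes
    w^T *m B *m w >= 0 to the trace. Cholesky elimination gives such a
    decomposition without eigenvalues: subtracting from A the matrix w *m w^T
    divided by A i i, for w = A *m e_i and A i i nonzero, leaves a psd matrix with
    fewer nonzero diagonal entries. *)
Lemma psd_trace_mul_ge0 (R : realType) (n : nat) (A B : 'M[R]_n) :
  psd A -> psd B -> 0 <= \tr (A *m B).
Proof.
move=> psdA psdB.
have [m] := ubnP #|[pred i | A i i != 0]|; elim: m => // m IHm in A psdA *.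
rewrite ltnS => leAm.
have [A0|/existsNP[i /eqP Ai]] := pselect (forall i, A i i = 0).
  by rewrite (psd_diag0 psdA A0) mul0mx mxtrace0.
have a0 : 0 < A i i by rewrite lt_def Ai psd_diag_ge0.
have symA : A^T = A by case: psdA; rewrite symmetricmxE => /eqP.
pose a := A i i; pose e : 'cV[R]_n := delta_mx i 0.
(* P^T projects onto the A-orthogonal complement of e, so P *m A *m P^T is A
   with its component along A *m e removed. It is psd as a congruence of A; its
   i-th diagonal entry vanishes and the zeros of the diagonal of A persist. *)
pose P : 'M[R]_n := 1%:M - a^-1 *: (A *m e *m e^T).
pose w := A *m e.
have eAe : e^T *m A *m e = a%:M.
  by rewrite [LHS]mx11_scalar -trace_mx11 quad_delta.
have A'E : P *m A *m P^T = A - a^-1 *: (w *m w^T).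
  have PAe : P *m A *m e = 0.
    rewrite mulmxBl mul1mx mulmxBl -!scalemxAl -!mulmxA (mulmxA e^T) eAe.
    by rewrite mulmxA scalar_mxC mul_scalar_mx scalerA mulVf ?scale1r ?subrr.
  rewrite {2}/P linearB /= trmx1 mulmxBr mulmx1 linearZ /= !trmx_mul trmxK symA.
  rewrite -scalemxAr !mulmxA PAe !mul0mx scaler0 subr0.
  by rewrite mulmxBl mul1mx -scalemxAl /w ?mulmxA.
have psdA' := psd_congr P psdA.
have A'0 j : (P *m A *m P^T) j j = A j j - a^-1 * A j i ^+ 2.
  by rewrite A'E /w -colE !mxE big_ord1 !mxE expr2.
have lt_diag : (#|[pred i0 | (P *m A *m P^T) i0 i0 != 0%R]| < m)%N.
  apply: leq_trans leAm; apply/proper_card/fintype.properP; split.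
    apply/fintype.subsetP => j; rewrite !inE; apply: contraNneq => Ajj.
    apply/eqP/le_anti; rewrite psd_diag_ge0 // andbT A'0 Ajj sub0r oppr_le0.
    by rewrite mulr_ge0 ?sqr_ge0 // invr_ge0 ltW.
  exists i; rewrite ?inE // negbK A'0 -/a.
  by rewrite expr2 mulrA mulVf ?mul1r ?subrr ?eqxx.
have := IHm _ psdA' lt_diag; rewrite A'E mulmxBl linearB subr_ge0.
apply: le_trans.
rewrite -scalemxAl linearZ mulr_ge0 ?invr_ge0 ?(ltW a0) //=.
by rewrite -(mulmxA w) mxtrace_mulC; case: psdB => _; apply.
Qed.

Lemma psdZ (R : realType) (n : nat) (a : R) (A : 'M[R]_n) :
  0 <= a -> psd A -> psd (a *: A).
Proof.
move=> a0 [symA posA]; split.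
  by move: symA; rewrite !symmetricmxE linearZ /= => /eqP ->.
by move=> v; rewrite -scalemxAr -scalemxAl linearZ /= mulr_ge0.
Qed.

Lemma psd_projector (R : realType) (n : nat) (Q : 'M[R]_n) :
  Q^T = Q -> Q *m Q = Q -> psd Q.
Proof.
move=> symQ idQ; split; first by rewrite symmetricmxE symQ.
move=> v.
have := trace_gram_ge0 (Q *m v).
by rewrite trmx_mul symQ !mulmxA -(mulmxA _ Q Q) idQ.
Qed.

(** The normalised projector onto the kernel of X. It attains the minimum, 0, of
    the Frobenius product with X when X is psd. *)
Lemma spectahedron_orthogonal (R : realType) (n : nat) (X : 'M[R]_n) :
  (\rank X < n)%N -> exists2 Y, spectahedron Y & frob_dot Y X = 0.
Proof.
move=> rX; have [P [symP idP XP trP]] := row_space_projector X.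
set Q : 'M[R]_n := 1%:M - P.
have symQ : Q^T = Q by rewrite /Q linearB /= trmx1 symP.
have idQ : Q *m Q = Q by rewrite /Q mulmxBr mulmx1 mulmxBl mul1mx idP subrr subr0.
have trQ : \tr Q = (n - \rank X)%:R.
  by rewrite linearB /= mxtrace1 trP natrB // ltnW.
have trQ0 : 0 < \tr Q by rewrite trQ ltr0n subn_gt0.
exists ((\tr Q)^-1 *: Q).
  split; last by rewrite linearZ /= mulVf // gt_eqF.
  by apply: psdZ; [rewrite invr_ge0 ltW | exact: psd_projector].
rewrite frob_dotZl /frob_dot symQ mxtrace_mulC.
by rewrite /Q mulmxBr mulmx1 XP subrr mxtrace0 mulr0.
Qed.

(** * The gradient of the squared norm *)

Lemma frob_norm_cvg0 (R : realType) (n : nat) :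
  frob_norm H @[H --> (0 : 'M[R]_n)] --> (0 : R).
Proof.
have -> : (0 : R) = Num.sqrt
    (\sum_(i < n) \sum_(j < n) (0 : 'M[R]_n) i j * (0 : 'M[R]_n) i j).
  by rewrite big1 ?sqrtr0 // => i _; rewrite big1 // => j _; rewrite mxE mul0r.
under eq_fun do rewrite /frob_norm frob_dotE.
apply: (@cvg_comp _ _ _ _ (@Num.sqrt R)); last exact: sqrt_continuous.
apply: cvg_big; [exact: add_continuous|exact: nbhs_filter|].
move=> i _; apply: cvg_big; [exact: add_continuous|exact: nbhs_filter|].
move=> j _; suff coord : (fun H : 'M[R]_n => H i j) H @[H --> (0 : 'M[R]_n)] -->
    (0 : 'M[R]_n) i j.
  exact: (cvgM coord coord).
move=> U /nbhs_ballP[e e0 eU]; apply/nbhs_ballP; exists e => //= H [_ ?]; exact: eU.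
Qed.

(** Rays along symmetric directions are admissible in the filter that defines the
    gradient; this is how uniqueness of the gradient is tested. *)
Lemma ray_cvg0 (R : realType) (n : nat) (D : 'M[R]_n) :
  D \is symmetricmx -> D != 0 ->
  t *: D @[t --> (0 : R)^'+] -->
    within (@symmetric_matrices R n) (0 : 'M[R]_n)^'.
Proof.
move=> symD D0 U; rewrite /within /= => /nbhs_ballP [e /= e0 eU].
change (\forall t \near (0 : R)^'+, U (t *: D)); near=> t.
have t0 : 0 < t by [].
have te : t * frob_norm D < e.
  rewrite -ltr_pdivlMr ?frob_norm_gt0 //; near: t.
  by apply: nbhs_right_lt; rewrite divr_gt0 ?frob_norm_gt0.
apply: (eU (t *: D)).
- split=> // i j; rewrite !mxE /ball /= sub0r normrN normrM (gtr0_norm t0).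
  by apply: le_lt_trans te; rewrite ler_pM2l // ler_entry_frob_norm.
- by rewrite scaler_eq0 (negbTE D0) (gt_eqF t0).
- move: symD; rewrite /symmetric_matrices /= !symmetricmxE linearZ /=.
  by move=> /eqP ->.
Unshelve. all: by end_near. Qed.

(** If D = G - G' were nonzero, the difference of the two quotients along the ray
    spanned by D would be constantly the norm of D, and would also tend to 0. Since
    D is symmetric, that ray stays inside the domain. *)
Lemma is_gradient_unique (R : realType) (n : nat) (f : 'M[R]_n -> R)
    (X G G' : 'M[R]_n) :
  is_gradient f X G -> is_gradient f X G' -> G = G'.
Proof.
move=> [symG dG] [symG' dG'].
apply/eqP; rewrite -subr_eq0; apply/negPn/negP; set D := G - G' => D0.
have symD : D \is symmetricmx.
  move: symG symG'; rewrite /symmetric_matrices /= !symmetricmxE.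
  by rewrite linearB /= => /eqP -> /eqP ->.
have dD : frob_dot D H / frob_norm H
    @[H --> within (@symmetric_matrices R n) (0 : 'M[R]_n)^'] --> (0 : R).
  pose q K H := (f (X + H) - f X - frob_dot K H) / frob_norm H.
  have -> : (fun H => frob_dot D H / frob_norm H) = q G' \- q G.
    by apply/funext => H; rewrite /q /= -mulrBl frob_dotBl; congr (_ * _); ring.
  by have := cvgB dG' dG; rewrite subrr; apply; do 2!apply: within_filter.
have lim0 := cvg_comp _ _ (ray_cvg0 symD D0) dD.
have limD : frob_dot D (t *: D) / frob_norm (t *: D) @[t --> (0 : R)^'+]
    --> frob_norm D.
  apply: cvg_near_cst; near=> t; have t0 : 0 < t by [].
  rewrite frob_dotC frob_dotZl frob_normZ ?ltW // -sqr_frob_norm.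
  by field; rewrite !gt_eqF // frob_norm_gt0.
by have := frob_norm_gt0 D0; rewrite (cvg_unique _ limD lim0) ?ltxx.
Unshelve. all: by end_near. Qed.

(** The remainder of the first-order expansion is exactly the squared norm of H. *)
Lemma is_gradient_sqr_frob_norm (R : realType) (n : nat) (X : 'M[R]_n) :
  X \is symmetricmx ->
  is_gradient (fun Z : 'M[R]_n => frob_norm Z ^+ 2) X (2 *: X).
Proof.
rewrite symmetricmxE => /eqP symX; split.
  by rewrite /symmetric_matrices /= symmetricmxE linearZ /= symX.
apply: cvg_within_filter; apply: cvg_within_filter.
have -> : (fun H : 'M[R]_n => (frob_norm (X + H) ^+ 2 - frob_norm X ^+ 2 -
    frob_dot (2 *: X) H) / frob_norm H) = (fun H => frob_norm H).
  apply/funext => H; rewrite !sqr_frob_norm frob_dotZl.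
  rewrite frob_dotDl ![frob_dot _ (X + H)]frob_dotC !frob_dotDl.
  rewrite (frob_dotC H X).
  rewrite (_ : _ - _ = frob_norm H ^+ 2); last by rewrite sqr_frob_norm; ring.
  (* At H = 0 the quotient is 0 by the convention on division by 0, and so is
     the norm. *)
  have [->|H0] := eqVneq (frob_norm H) 0; first by rewrite expr0n mul0r.
  by rewrite expr2 mulfK.
exact: frob_norm_cvg0.
Qed.

Lemma gradient_sqr_frob_norm (R : realType) (n : nat) (X : 'M[R]_n) :
  X \is symmetricmx ->
  gradient (fun Z : 'M[R]_n => frob_norm Z ^+ 2) X = 2 *: X.
Proof.
move=> /is_gradient_sqr_frob_norm gX; apply: xget_unique => // G gG.
exact: is_gradient_unique gG gX.
Qed.

(** * The duality gap *)

Lemma maximum_eq (R : realType) (E : set R) (m : R) :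
  E m -> ubound E m -> maximum E = m.
Proof.
move=> Em ubm; apply: xget_unique => // y [Ey uby].
by apply/le_anti/andP; split; [exact: ubm | exact: uby].
Qed.

Theorem lemma22 (R : realType) (n k : nat) (hk0 : (0 < k)%N) (hkn : (k < n)%N)
    (X : 'M[R]_n) (hX : spectahedron X) (hrk : (\rank X <= k)%N) :
  1 / k%:R <= duality_gap (fun Z : 'M[R]_n => frob_norm Z ^+ 2) X.
Proof.
have [[symX posX] trX] := hX.
rewrite /duality_gap gradient_sqr_frob_norm //.
have gapE Y : frob_dot (X - Y) (2 *: X) = 2 * frob_dot X X - 2 * frob_dot Y X.
  by rewrite frob_dotC frob_dotZl frob_dotC frob_dotBl mulrBr.
rewrite (@maximum_eq _ _ (2 * frob_dot X X)); first last.
- move=> _ [Y [psdY _] <-]; rewrite gapE gerBl mulr_ge0 // /frob_dot.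
  have /eqP -> : Y^T == Y by rewrite -symmetricmxE; case: psdY.
  by apply: psd_trace_mul_ge0 => //; split.
- have [Y specY YX] := spectahedron_orthogonal (leq_ltn_trans hrk hkn).
  by exists Y => //; rewrite gapE YX mulr0 subr0.
have XX0 := frob_dot_ge0 X.
have kXX : 1 <= frob_dot X X * k%:R.
  have := sqr_trace_le_rank X; rewrite trX expr1n => /le_trans; apply.
  by rewrite mulrC ler_wpM2l // ler_nat.
rewrite ler_pdivrMr ?ltr0n //; apply: le_trans kXX _.
by rewrite ler_wpM2r //; lra.
Qed.
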